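(* Let $m\ge 1$ be odd, let $V$ be a real vector space of dimension $m$, and let $s=\{s_0,\dots,s_{m-1}\}$, $t=\{t_0,\dots,t_{m-1}\}$ and $v=\{v_0,\dots,v_{m-1}\}$ be ordered bases of $V$. Suppose that for all $0\le r\le m-1$, $$s_r=\sum_{k=0}^{r}\alpha_1(r,k)\,t_{r-k},\qquad v_r=\sum_{k=0}^{r}\alpha_2(r,k)\,s_{r-k},\qquad v_r=\sum_{k=0}^{r}\alpha_3(r,k)\,t_{r-k},$$ with real coefficients, and that $\alpha_1(r,k)=0$ and $\alpha_2(r,k)=0$ whenever $k$ is odd and $0\le k\le r\le m-1$. Let $n=m-1$. Then for all integers $k$ with $0\le k\le \frac n2$, $$\alpha_3(n,2k)=\sum_{j=0}^{k}\alpha_1\bigl(n-2j,\,2(k-j)\bigr)\,\alpha_2(n,2j).$$ Equivalently, putting $\beta_i(r,k)=\alpha_i(r,2k)$ for $0\le k\le\lfloor r/2\rfloor$ and $i=1,2,3$, $$\beta_3(n,k)=\sum_{j=0}^{k}\beta_1(n-2j,\,k-j)\,\beta_2(n,j)\qquad\Bigl(0\le k\le \tfrac n2\Bigr).$$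
   Context: The functions $\alpha_1,\alpha_2,\alpha_3$ are the coefficient functions of the changes of basis $s\to t$, $v\to s$ and $v\to t$ respectively. The vanishing hypothesis for odd $k$ is the situation arising when, for instance, $s$ consists of monomials and $t$, $v$ consist of polynomials of definite parity ($t_r$ and $v_r$ having degree $r$ and the parity of $r$). *)

(* Defs.v *)
From mathcomp Require Export all_boot all_order all_algebra reals.

Set Implicit Arguments.
Unset Strict Implicit.
Unset Printing Implicit Defensive.

(* Main.v *)
(** Substituting [s -> t] into [v -> s] and comparing the coordinates of [v_r]
    along [t_(r-l)] gives
    [alpha3 r l = \sum_(j <= l) alpha1 (r-j) (l-j) * alpha2 r j] for every [r]
    and [l]; for [l = 2k], only the even [j] contribute. *)

Require Import Defs.
From mathcomp Require Import all_boot all_order all_algebra reals.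
From mathcomp Require Import zify.

Set Implicit Arguments.
Unset Strict Implicit.
Unset Printing Implicit Defensive.

Import Order.TTheory GRing.Theory Num.Theory.
Local Open Scope ring_scope.

(** By induction on [k]: each step appends the indices [2k+1], whose term vanishes, and [2k+2]. The
    range ends at an even index, so every odd index lies strictly below [2k]. *)
Lemma sum_nat_even (V : nmodType) (F : nat -> V) (k : nat) :
  (forall j, (j < 2 * k)%N -> odd j -> F j = 0) ->
  \sum_(0 <= j < (2 * k).+1) F j = \sum_(0 <= j < k.+1) F (2 * j)%N.
Proof.
elim: k => [|k IHk] F0; first by rewrite !big_nat1.
rewrite [RHS]big_nat_recr //= -IHk => [|j jk]; last by apply: F0; lia.
rewrite mulnS !addSn add0n [LHS]big_nat_recr //=; congr (_ + _).
by rewrite big_nat_recr //= [F _.+1]F0 ?addr0 ?mulnS //= mul2n odd_double.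
Qed.

(** Reversing the summation indexes the terms by the subscript of [t]; freeness then makes each
    coordinate a Kronecker delta, nonzero only if [i] is among the subscripts [0..r]. *)
Lemma coord_rev_sum (K : fieldType) (V : vectType K) (m : nat)
    (t : m.-tuple V) (a : nat -> K) (r : nat) (i : 'I_m) :
  free t -> (r < m)%N ->
  coord t i (\sum_(0 <= k < r.+1) a k *: t`_(r - k)) =
    if (i <= r)%N then a (r - i)%N else 0.
Proof.
move=> free_t rm; rewrite big_nat_rev add0n linear_sum /=.
(* The conditional becomes a sum over the same range filtered by [k == i], so the two sides can be
   compared term by term. *)
rewrite -ltnS -[RHS](big_nat1_eq +%R (fun k => a (r - k)%N) i 0%N r.+1).
rewrite [RHS]big_mkcond; apply: eq_big_nat => k /andP[_ kr].
have km : (k < m)%N by lia.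
rewrite subSS linearZ /= subKn // (coord_free (Ordinal km) i free_t) -val_eqE /=.
by case: eqP; rewrite ?mulr1 ?mulr0.
Qed.

Lemma triangular_coef_comp (K : fieldType) (V : vectType K) (m : nat)
    (s t v : m.-tuple V) (a1 a2 a3 : nat -> nat -> K) :
  free t ->
  (forall r, (r < m)%N ->
    s`_r = \sum_(0 <= k < r.+1) a1 r k *: t`_(r - k)) ->
  (forall r, (r < m)%N ->
    v`_r = \sum_(0 <= k < r.+1) a2 r k *: s`_(r - k)) ->
  (forall r, (r < m)%N ->
    v`_r = \sum_(0 <= k < r.+1) a3 r k *: t`_(r - k)) ->
  forall r l, (l <= r < m)%N ->
  a3 r l = \sum_(0 <= j < l.+1) a1 (r - j)%N (l - j)%N * a2 r j.
Proof.
move=> free_t s_t v_s v_t r l /andP[lr rm].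
(* The coordinate of index [r - l] isolates [a3 r l], since [r - (r - l) = l]. *)
have im : (r - l < m)%N by lia.
have := congr1 (coord t (Ordinal im)) (v_t r rm).
rewrite coord_rev_sum //= leq_subr subKn // => <-.
(* The tail [j > l] contributes nothing: [s_(r-j)] involves only [t_i] with [i <= r - j < r - l]. *)
rewrite v_s // linear_sum /= (big_cat_nat (n := l.+1)) //=.
rewrite [X in _ + X]big_nat_cond [X in _ + X]big1 ?addr0.
  apply: eq_big_nat => j /andP[_ jl].
  rewrite linearZ /= s_t ?coord_rev_sum //=; try lia.
  have -> : (r - l <= r - j)%N by lia.
  have -> : (r - j - (r - l) = l - j)%N by lia.
  exact: mulrC.
move=> j /andP[/andP[lj jr] _].
rewrite linearZ /= s_t ?coord_rev_sum //=; try lia.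
have -> : (r - l <= r - j)%N = false by lia.
exact: mulr0.
Qed.

Theorem mainTheorem3 (R : realType) (V : vectType R) (m : nat)
    (hm1 : (1 <= m)%N) (hmodd : odd m) (hdim : \dim {:V} = m)
    (s t v : m.-tuple V)
    (hs : basis_of {:V} s) (ht : basis_of {:V} t) (hv : basis_of {:V} v)
    (alpha1 alpha2 alpha3 : nat -> nat -> R)
    (h1 : forall r : nat, (r <= m - 1)%N ->
       s`_r = \sum_(0 <= k < r.+1) alpha1 r k *: t`_(r - k))
    (h2 : forall r : nat, (r <= m - 1)%N ->
       v`_r = \sum_(0 <= k < r.+1) alpha2 r k *: s`_(r - k))
    (h3 : forall r : nat, (r <= m - 1)%N ->
       v`_r = \sum_(0 <= k < r.+1) alpha3 r k *: t`_(r - k))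
    (hodd1 : forall r k : nat,
       (k <= r)%N -> (r <= m - 1)%N -> odd k -> alpha1 r k = 0)
    (hodd2 : forall r k : nat,
       (k <= r)%N -> (r <= m - 1)%N -> odd k -> alpha2 r k = 0) :
  let n := (m - 1)%N in
  (forall k : nat, (2 * k <= n)%N ->
     alpha3 n (2 * k)%N =
       \sum_(0 <= j < k.+1)
          alpha1 (n - 2 * j)%N (2 * (k - j))%N * alpha2 n (2 * j)%N)
  /\
  (forall beta1 beta2 beta3 : nat -> nat -> R,
     (forall r k : nat, (r <= m - 1)%N -> (k <= r./2)%N ->
        [/\ beta1 r k = alpha1 r (2 * k)%N,
            beta2 r k = alpha2 r (2 * k)%N
          & beta3 r k = alpha3 r (2 * k)%N]) ->
     forall k : nat, (2 * k <= n)%N ->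
       beta3 n k =
         \sum_(0 <= j < k.+1) beta1 (n - 2 * j)%N (k - j)%N * beta2 n j).
Proof.
move=> n.
have evenP k : (2 * k <= n)%N -> alpha3 n (2 * k)%N =
    \sum_(0 <= j < k.+1)
       alpha1 (n - 2 * j)%N (2 * (k - j))%N * alpha2 n (2 * j)%N.
  move=> kn.
  have below r : (r < m)%N -> (r <= m - 1)%N by lia.
  rewrite (@triangular_coef_comp _ _ _ s t v alpha1 alpha2 alpha3) //.
  (* For odd [j < 2k <= n], the factor [alpha2 n j] vanishes. *)
  - rewrite sum_nat_even => [|j jk oj].
      by apply: eq_big_nat => j _; rewrite mulnBr.
    by rewrite hodd2 ?mulr0 //; lia.
  - exact: basis_free ht.
  - by move=> r /below; apply: h1.
  - by move=> r /below; apply: h2.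
  - by move=> r /below; apply: h3.
  - by rewrite kn /n; lia.
split=> // b1 b2 b3 hb k kn.
(* The [beta]s are tied to the [alpha]s only for second arguments up to [r./2], so each replacement
   checks its range; for [beta1] this is [k - j <= (n - 2j)./2], which follows from [2k <= n]. *)
have [_ _ ->] := hb n k (leqnn _) ltac:(lia).
rewrite evenP //; apply: eq_big_nat => j /andP[_ jk].
have [_ -> _] := hb n j (leqnn _) ltac:(lia).
by have [-> _ _] := hb (n - 2 * j)%N (k - j)%N ltac:(lia) ltac:(lia).
Qed.
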